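(* Let $m\ge0$ be an integer, $x\in\mathbb R$ and $q\in\mathbb H$. Then $$\sum_{n=0}^\infty\frac{H_n(x)\,H^Q_{m,n}(q,\overline q)}{n!}=e^{-\overline q^{\,2}+2x\overline q}\,H_m\left(\overline q+\frac q2-x\right).$$
   Context: $\mathbb H$ is the algebra of real quaternions, $\overline q$ the quaternionic conjugate, $e^q=\sum_{n\ge0}q^n/n!$. $H_n(x)=(-1)^n e^{x^2}\frac{d^n}{dx^n}(e^{-x^2})$ are the classical real Hermite polynomials; for a quaternion $p$, $H_m(p)$ is the value at $p$ of the polynomial $H_m$ (which has real coefficients). For integers $m,n\ge0$, $$H^Q_{m,n}(q,\overline q)=\sum_{k=0}^{\min(m,n)}(-1)^k k!\binom mk\binom nk q^{m-k}\overline q^{\,n-k}.$$ *)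

(* Defs.v *)
From HB Require Import structures.
From mathcomp Require Import all_boot all_order all_algebra.
From mathcomp Require Import all_classical all_reals all_analysis.
From mathcomp Require Import ring lra.

Set Implicit Arguments.
Unset Strict Implicit.
Unset Printing Implicit Defensive.

Import Order.TTheory GRing.Theory Num.Theory.
Import numFieldNormedType.Exports.

Local Open Scope classical_set_scope.
Local Open Scope ring_scope.

(* The quaternion [Quat a b c d] is a + b i + c j + d k. *)
Record quat (R : realType) := Quat { qre : R; qi : R; qj : R; qk : R }.

Section QuatAlgebra.
Variable R : realType.
Implicit Types (p q r : quat R) (a b : R).

Definition tuple_of_quat q := (qre q, qi q, qj q, qk q).
Definition quat_of_tuple (t : R * R * R * R) :=
  let: (a, b, c, d) := t in Quat a b c d.

Lemma tuple_of_quatK : cancel tuple_of_quat quat_of_tuple.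
Proof. by case. Qed.

HB.instance Definition _ := Choice.copy (quat R) (can_type tuple_of_quatK).

Lemma quat_eqP p q :
  qre p = qre q -> qi p = qi q -> qj p = qj q -> qk p = qk q -> p = q.
Proof. by case: p q => [????] [????] /= -> -> -> ->. Qed.

Definition quat_zero : quat R := Quat 0 0 0 0.
Definition quat_opp q := Quat (- qre q) (- qi q) (- qj q) (- qk q).
Definition quat_add p q :=
  Quat (qre p + qre q) (qi p + qi q) (qj p + qj q) (qk p + qk q).

Fact quat_addA : associative quat_add.
Proof. by move=> p q r; apply: quat_eqP; rewrite /= addrA. Qed.
Fact quat_addC : commutative quat_add.
Proof. by move=> p q; apply: quat_eqP; rewrite /= addrC. Qed.
Fact quat_add0 : left_id quat_zero quat_add.
Proof. by move=> p; apply: quat_eqP; rewrite /= add0r. Qed.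
Fact quat_addN : left_inverse quat_zero quat_opp quat_add.
Proof. by move=> p; apply: quat_eqP; rewrite /= addNr. Qed.

HB.instance Definition _ := GRing.isZmodule.Build (quat R)
  quat_addA quat_addC quat_add0 quat_addN.

Definition quat_one : quat R := Quat 1 0 0 0.
Definition quat_mul p q := Quat
  (qre p * qre q - qi p * qi q - qj p * qj q - qk p * qk q)
  (qre p * qi q + qi p * qre q + qj p * qk q - qk p * qj q)
  (qre p * qj q - qi p * qk q + qj p * qre q + qk p * qi q)
  (qre p * qk q + qi p * qj q - qj p * qi q + qk p * qre q).

Fact quat_mulA : associative quat_mul.
Proof. by move=> p q r; apply: quat_eqP => /=; ring. Qed.
Fact quat_mul1r : left_id quat_one quat_mul.
Proof. by move=> p; apply: quat_eqP => /=; ring. Qed.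
Fact quat_mulr1 : right_id quat_one quat_mul.
Proof. by move=> p; apply: quat_eqP => /=; ring. Qed.
Fact quat_mulDl : left_distributive quat_mul +%R.
Proof. by move=> p q r; apply: quat_eqP => /=; ring. Qed.
Fact quat_mulDr : right_distributive quat_mul +%R.
Proof. by move=> p q r; apply: quat_eqP => /=; ring. Qed.
Fact quat_oner_neq0 : quat_one != 0.
Proof. by apply/eqP => -[] /eqP; rewrite oner_eq0. Qed.

HB.instance Definition _ := GRing.Zmodule_isNzRing.Build (quat R)
  quat_mulA quat_mul1r quat_mulr1 quat_mulDl quat_mulDr quat_oner_neq0.

Definition quat_scale a q := Quat (a * qre q) (a * qi q) (a * qj q) (a * qk q).

Fact quat_scaleA a b q :
  quat_scale a (quat_scale b q) = quat_scale (a * b) q.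
Proof. by apply: quat_eqP; rewrite /= mulrA. Qed.
Fact quat_scale1 : left_id 1 quat_scale.
Proof. by move=> q; apply: quat_eqP; rewrite /= mul1r. Qed.
Fact quat_scaleDr : right_distributive quat_scale +%R.
Proof. by move=> a p q; apply: quat_eqP; rewrite /= mulrDr. Qed.
Fact quat_scaleDl q : {morph quat_scale^~ q : a b / a + b}.
Proof. by move=> a b; apply: quat_eqP; rewrite /= mulrDl. Qed.

HB.instance Definition _ := GRing.Zmodule_isLmodule.Build R (quat R)
  quat_scaleA quat_scale1 quat_scaleDr quat_scaleDl.

Fact quat_scaleAl a p q : a *: (p * q) = (a *: p) * q.
Proof. by apply: quat_eqP => /=; ring. Qed.
Fact quat_scaleAr a p q : a *: (p * q) = p * (a *: q).
Proof. by apply: quat_eqP => /=; ring. Qed.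

HB.instance Definition _ :=
  GRing.Lmodule_isLalgebra.Build R (quat R) quat_scaleAl.
HB.instance Definition _ :=
  GRing.Lalgebra_isAlgebra.Build R (quat R) quat_scaleAr.

Definition quat_conj q := Quat (qre q) (- qi q) (- qj q) (- qk q).

Definition quat_norm q :=
  Num.sqrt (qre q ^+ 2 + qi q ^+ 2 + qj q ^+ 2 + qk q ^+ 2).

Fact quat_norm_ge0 q : 0 <= quat_norm q. Proof. exact: sqrtr_ge0. Qed.

Fact sqr_quat_norm q :
  quat_norm q ^+ 2 = qre q ^+ 2 + qi q ^+ 2 + qj q ^+ 2 + qk q ^+ 2.
Proof. by rewrite sqr_sqrtr// !addr_ge0// sqr_ge0. Qed.

Fact quat_normM p q : quat_norm (p * q) = quat_norm p * quat_norm q.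
Proof.
rewrite /quat_norm -sqrtrM; last by rewrite !addr_ge0// sqr_ge0.
by congr Num.sqrt => /=; ring.
Qed.

Fact qre_le_norm q : `|qre q| <= quat_norm q.
Proof.
rewrite -sqrtr_sqr ler_wsqrtr//.
by have := (sqr_ge0 (qi q), sqr_ge0 (qj q), sqr_ge0 (qk q)) => -[[]]; lra.
Qed.

Fact qi_le_norm q : `|qi q| <= quat_norm q.
Proof.
rewrite -sqrtr_sqr ler_wsqrtr//.
by have := (sqr_ge0 (qre q), sqr_ge0 (qj q), sqr_ge0 (qk q)) => -[[]]; lra.
Qed.

Fact qj_le_norm q : `|qj q| <= quat_norm q.
Proof.
rewrite -sqrtr_sqr ler_wsqrtr//.
by have := (sqr_ge0 (qre q), sqr_ge0 (qi q), sqr_ge0 (qk q)) => -[[]]; lra.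
Qed.

Fact qk_le_norm q : `|qk q| <= quat_norm q.
Proof.
rewrite -sqrtr_sqr ler_wsqrtr//.
by have := (sqr_ge0 (qre q), sqr_ge0 (qi q), sqr_ge0 (qj q)) => -[[]]; lra.
Qed.

Fact quat_norm_conj q : quat_norm (quat_conj q) = quat_norm q.
Proof. by rewrite /quat_norm /= !sqrrN. Qed.

(* The real part of p * conj q is the Euclidean inner product. *)
Fact quat_ler_normD p q : quat_norm (p + q) <= quat_norm p + quat_norm q.
Proof.
rewrite -(@ler_pXn2r _ 2)// ?nnegrE ?addr_ge0 ?quat_norm_ge0//.
have := le_trans (ler_norm _) (qre_le_norm (p * quat_conj q)).
rewrite quat_normM quat_norm_conj sqrrD !sqr_quat_norm /=; lra.
Qed.

Fact quat_normZ a q : quat_norm (a *: q) = `|a| * quat_norm q.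
Proof.
rewrite /quat_norm /= !exprMn -!mulrDr sqrtrM ?sqr_ge0//.
by rewrite sqrtr_sqr.
Qed.

Fact quat_norm0_eq0 q : quat_norm q = 0 -> q = 0.
Proof.
move=> q0; apply: quat_eqP; apply/eqP; rewrite -normr_le0 -q0.
- exact: qre_le_norm.
- exact: qi_le_norm.
- exact: qj_le_norm.
- exact: qk_le_norm.
Qed.

HB.instance Definition _ := Lmodule_isNormed.Build R (quat R)
  quat_ler_normD quat_normZ quat_norm0_eq0.

End QuatAlgebra.

Section QuatComplete.
Variable R : realType.
Implicit Types (q : quat R) (F : set_system (quat R)).

Lemma quat_normE q :
  `|q| = Num.sqrt (qre q ^+ 2 + qi q ^+ 2 + qj q ^+ 2 + qk q ^+ 2).
Proof. by []. Qed.

Fact quat_norm_le q : `|q| <= `|qre q| + `|qi q| + `|qj q| + `|qk q|.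
Proof.
rewrite quat_normE -(@ler_pXn2r _ 2)// ?nnegrE ?addr_ge0 ?sqrtr_ge0//.
rewrite sqr_sqrtr ?addr_ge0 ?sqr_ge0//.
rewrite -(real_normK (num_real (qre q))) -(real_normK (num_real (qi q))).
rewrite -(real_normK (num_real (qj q))) -(real_normK (num_real (qk q))).
move: `|qre q| `|qi q| `|qj q| `|qk q|
  (normr_ge0 (qre q)) (normr_ge0 (qi q)) (normr_ge0 (qj q))
  (normr_ge0 (qk q)) => a b c d a0 b0 c0 d0.
rewrite (_ : (a + b + c + d) ^+ 2 = a ^+ 2 + b ^+ 2 + c ^+ 2 + d ^+ 2
  + 2 * (a * b + a * c + a * d + b * c + b * d + c * d)); last by ring.
by rewrite lerDl mulr_ge0// !addr_ge0// mulr_ge0.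
Qed.

Fact quat_cvg_coord (f : quat R -> R) F :
  {morph f : p q / p - q} -> (forall q, `|f q| <= `|q|) ->
  ProperFilter F -> cauchy F -> cvg (f @ F).
Proof.
move=> fB f_le FF /cauchyP Fc; apply: cauchy_cvg; apply: cauchy_exP => e e0.
have [q qF] := Fc _ e0; exists (f q); apply: (@filterS _ F _ _ _ _ qF) => p.
by rewrite -!ball_normE /= -fB; exact: le_lt_trans.
Qed.

Fact quat_cauchy_cvg F : ProperFilter F -> cauchy F -> cvg F.
Proof.
move=> FF Fc.
have /cvg_ex[a Fa] : cvg (@qre R @ F) by apply: quat_cvg_coord => //;
  exact: qre_le_norm.
have /cvg_ex[b Fb] : cvg (@qi R @ F) by apply: quat_cvg_coord => //;
  exact: qi_le_norm.
have /cvg_ex[c Fq] : cvg (@qj R @ F) by apply: quat_cvg_coord => //;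
  exact: qj_le_norm.
have /cvg_ex[d Fd] : cvg (@qk R @ F) by apply: quat_cvg_coord => //;
  exact: qk_le_norm.
apply/cvg_ex; exists (Quat a b c d); apply/fcvgrPdist_lt => e e0.
have e4 : 0 < e / 4 by rewrite divr_gt0.
near=> q; apply: (le_lt_trans (quat_norm_le _)) => /=.
have : `|a - qre q| < e / 4 by near: q; move/cvgrPdist_lt : Fa; exact.
have : `|b - qi q| < e / 4 by near: q; move/cvgrPdist_lt : Fb; exact.
have : `|c - qj q| < e / 4 by near: q; move/cvgrPdist_lt : Fq; exact.
have : `|d - qk q| < e / 4 by near: q; move/cvgrPdist_lt : Fd; exact.
by lra.
Unshelve. all: by end_near. Qed.

HB.instance Definition _ := Uniform_isComplete.Build (quat R) quat_cauchy_cvg.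

End QuatComplete.

Section Hermite.
Variable R : realType.
Implicit Types (x : R) (q : quat R) (m n : nat).

Definition expq_coeff q : nat -> quat R := fun n => n`!%:R^-1 *: q ^+ n.

Definition expq q : quat R := limn (series (expq_coeff q)).

Lemma is_cvg_series_expq q : cvgn (series (expq_coeff q)).
Proof.
have qXn n : `|q ^+ n| = `|q| ^+ n.
  elim: n => [|n IH]; last by rewrite !exprS [LHS]quat_normM -IH.
  by rewrite !expr0 quat_normE /= expr1n !expr0n /= !addr0 sqrtr1.
apply: normed_cvg; rewrite (_ : [normed _] = series (exp_coeff `|q|)).
  exact: is_cvg_series_exp_coeff.
congr series; apply/funext => n /=.
by rewrite /expq_coeff normrZ qXn normfV normr_nat mulrC.
Qed.

Definition hermite n x : R :=
  (-1) ^+ n * expR (x ^+ 2) * derive1n n (fun t : R => expR (- t ^+ 2)) x.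

(* The polynomial whose values are given by [hermite n]; it exists by
   [horner_hermite_poly] and is unique since R is infinite. *)
Definition hermite_poly n : {poly R} :=
  xget 0 [set p | forall x, p.[x] = hermite n x].

Lemma horner_hermite_poly n x : (hermite_poly n).[x] = hermite n x.
Proof.
move: x; rewrite -[forall x, _]/((fun p : {poly R} =>
  forall x, p.[x] = hermite n x) (hermite_poly n)); apply: xgetPex.
have [p pE] : exists p : {poly R},
    derive1n n (fun t : R => expR (- t ^+ 2)) = fun x => p.[x] * expR (- x ^+ 2).
  elim: n => [|n [p IH]].
    by exists 1; apply/funext => x; rewrite hornerE mul1r.
  exists (p^`() - 2%:P * 'X * p); apply/funext => x.
  rewrite derive1nS IH derive1E.
  have d1 : is_derive x 1 (fun t : R => - t ^+ 2) (- (2 * x)).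
    by apply: is_derive_eq; rewrite /GRing.scale /=; ring.
  have d2 : is_derive x 1 (fun t : R => expR (- t ^+ 2))
              (expR (- x ^+ 2) * - (2 * x)).
    exact: (@is_derive1_comp R expR (fun t : R => - t ^+ 2)).
  have d3 : is_derive x 1 (fun t : R => p.[t] * expR (- t ^+ 2))
      (p.[x] *: (expR (- x ^+ 2) * - (2 * x)) + expR (- x ^+ 2) *: p^`().[x]).
    exact: (@is_deriveM R R (horner p) (fun t : R => expR (- t ^+ 2))).
  by rewrite derive_val !hornerE /GRing.scale /=; ring.
exists ((-1) ^+ n *: p) => x.
rewrite /hermite pE hornerZ expRN; field; exact: lt0r_neq0 (expR_gt0 _).
Qed.

Definition hermiteQ m n q : quat R :=
  \sum_(k < (minn m n).+1)
    ((-1) ^+ k * (k`! * 'C(m, k) * 'C(n, k))%:R) *: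
      (q ^+ (m - k) * quat_conj q ^+ (n - k)).

End Hermite.

(* Main.v *)
Require Import Defs.
From HB Require Import structures.
From mathcomp Require Import all_boot all_order all_algebra.
From mathcomp Require Import all_classical all_reals all_analysis.
From mathcomp Require Import ring zify.

Import Order.TTheory GRing.Theory Num.Theory.
Import numFieldNormedType.Exports.

Local Open Scope classical_set_scope.
Local Open Scope ring_scope.

(** Write F_m for the sum of the series and y = q' + q/2 - x, where q'
    is the conjugate of q.  Both sides satisfy the same three-term recurrence
    in m, and they agree for m = 0.

    Recurrence.  The polynomials H^Q satisfy
      H^Q_(m+1,n) = H^Q_(m,n) q - n H^Q_(m,n-1)  and
      H^Q_(m,n+1) = H^Q_(m,n) q' - m H^Q_(m-1,n)
    ([hermiteQSl], [hermiteQSr]).  Use the first to raise m, then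
    H_(n+1)(x) = 2 x H_n(x) - 2 n H_(n-1)(x) ([hermiteS]) to lower the index of
    the real factor, then the second to absorb the shift in n: this gives
      F_(m+1) = F_m (q - 2x + 2 q') - 2 m F_(m-1) = F_m (2y) - 2 m F_(m-1),
    which is the recurrence of H_m(y).  The computation is an identity between
    partial sums ([series_hermite_termS]), so convergence for m + 1 follows
    from convergence for m and m - 1, with no estimate.  Multiplying on the
    right keeps the exponential factor of F_m out of the way.

    Case m = 0.  This is the generating function
      sum_n H_n(x) p^n / n! = exp(2xp - p^2)  at a quaternion p
    ([hermite_generating]).  Put P_j = (2xX - X^2)^j / j!, a real polynomial.
    The N-th partial sum of the exponential is G_N(p), where G_N is the sum of
    the P_j with j < N.  Differentiating P_(j+1) shows that the coefficient of
    X^n in G_N, for n < N, is H_n(x)/n! ([sum_gen_term_coef]); so the N-th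
    partial sum of the Hermite series is the value at p of G_N truncated to
    degree less than N.  Truncation does not change P_j if 2j < N, and
    otherwise costs at most r^j / j! with r = 2|x||p| + |p|^2.  The two partial
    sums therefore differ by at most a tail of the series of exp(r). *)

(** * Real Hermite polynomials *)

Lemma poly_eq_horner (R : numDomainType) (P Q : {poly R}) :
  (forall x, P.[x] = Q.[x]) -> P = Q.
Proof.
move=> PQ; apply/eqP; rewrite -subr_eq0; apply/eqP.
apply: (@roots_geq_poly_eq0 _ _ [seq i%:R | i <- iota 0 (size (P - Q))]).
- by apply/allP => y _; rewrite rootE !hornerE PQ subrr.
- by rewrite map_inj_uniq ?iota_uniq//; exact: mulrIn (oner_neq0 R).
- by rewrite size_map size_iota.
Qed.

(** The definition of [hermite] solved for the derivative, so that it can be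
    differentiated once more. *)
Lemma derive1n_gauss (R : realType) n :
  derive1n n (fun t : R => expR (- t ^+ 2)) =
  fun x => ((-1) ^+ n *: hermite_poly R n).[x] * expR (- x ^+ 2).
Proof.
apply/funext => x; rewrite hornerZ horner_hermite_poly /hermite expRN.
rewrite !mulrA -exprMn mulrNN mulr1 expr1n; field.
exact: lt0r_neq0 (expR_gt0 _).
Qed.

Lemma hermite_polyS_deriv (R : realType) n :
  hermite_poly R n.+1 = 2 *: ('X * hermite_poly R n) - (hermite_poly R n)^`().
Proof.
apply: poly_eq_horner => x; rewrite [LHS]horner_hermite_poly /hermite.
rewrite derive1nS derive1n_gauss derive1E.
set p := (-1) ^+ n *: hermite_poly R n.
have d1 : is_derive x 1 (fun t : R => - t ^+ 2) (- (2 * x)).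
  by apply: is_derive_eq; rewrite /GRing.scale /=; ring.
have d2 : is_derive x 1 (fun t : R => expR (- t ^+ 2))
            (expR (- x ^+ 2) * - (2 * x)).
  exact: (@is_derive1_comp R expR (fun t : R => - t ^+ 2)).
have d3 : is_derive x 1 (fun t : R => p.[t] * expR (- t ^+ 2))
    (p.[x] *: (expR (- x ^+ 2) * - (2 * x)) + expR (- x ^+ 2) *: p^`().[x]).
  exact: (@is_deriveM R R (horner p) (fun t : R => expR (- t ^+ 2))).
rewrite derive_val /p derivZ !hornerE /GRing.scale /= expRN exprS.
have s2 : (-1) ^+ n * (-1) ^+ n = 1 :> R by rewrite -exprMn mulrNN mulr1 expr1n.
have e0 : expR (x ^+ 2) != 0 := lt0r_neq0 (expR_gt0 _).
transitivity (((-1) ^+ n * (-1) ^+ n) *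
  (2 * x * (hermite_poly R n).[x] - (hermite_poly R n)^`().[x])).
  by field.
by rewrite s2 mul1r.
Qed.

Lemma hermite_poly0 (R : realType) : hermite_poly R 0 = 1.
Proof.
apply: poly_eq_horner => x; rewrite horner_hermite_poly hornerE.
by rewrite /hermite expr0 mul1r /= expRN divff// lt0r_neq0// expR_gt0.
Qed.

(** The Appell property; by induction, since differentiating
    H_(n+1) = 2 X H_n - H_n' gives 2 H_n + 2 n (2 X H_(n-1) - H_(n-1)'). *)
Lemma deriv_hermite_poly (R : realType) n :
  (hermite_poly R n)^`() = (2 * n%:R) *: hermite_poly R n.-1.
Proof.
elim: n => [|n IH]; first by rewrite hermite_poly0 derivC mulr0 scale0r.
rewrite {1}hermite_polyS_deriv derivB derivZ derivM derivX mul1r IH derivZ.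
case: n IH => [|n] IH /=.
  by rewrite !(mulr0, scale0r, subr0, addr0, mulr1).
rewrite (hermite_polyS_deriv R n) -scalerAr -!mul_polyC !rmorphM /=.
rewrite !polyC_natr -!(natr1 n.+1). ring.
Qed.

Lemma hermite_polyS (R : realType) n :
  hermite_poly R n.+1 =
  2 *: ('X * hermite_poly R n) - (2 * n%:R) *: hermite_poly R n.-1.
Proof. by rewrite hermite_polyS_deriv deriv_hermite_poly. Qed.

Lemma hermiteS (R : realType) n (x : R) :
  hermite n.+1 x = 2 * x * hermite n x - 2 * n%:R * hermite n.-1 x.
Proof.
by rewrite -!horner_hermite_poly hermite_polyS !hornerE.
Qed.

Definition hermite_coef {R : realType} (x : R) n := hermite n x / n`!%:R.

Lemma hermite_coef0 (R : realType) (x : R) : hermite_coef x 0 = 1.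
Proof.
by rewrite /hermite_coef -horner_hermite_poly hermite_poly0 hornerE divr1.
Qed.

Lemma hermite_coef1 (R : realType) (x : R) : hermite_coef x 1 = 2 * x.
Proof.
rewrite /hermite_coef hermiteS mulr0 mul0r subr0 -horner_hermite_poly.
by rewrite hermite_poly0 hornerE mulr1 divr1.
Qed.

(** The recurrence of H_n divided by (n+1)!: multiplying by the index absorbs
    the factor n of the three-term recurrence. *)
Lemma hermite_coefSS (R : realType) (x : R) n :
  n.+2%:R * hermite_coef x n.+2 =
  2 * x * hermite_coef x n.+1 - 2 * hermite_coef x n.
Proof.
rewrite /hermite_coef hermiteS /= !factS !natrM.
have f0 : n`!%:R != 0 :> R by rewrite pnatr_eq0 -lt0n fact_gt0.
have n1 : n.+1%:R != 0 :> R by rewrite pnatr_eq0.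
have n2 : n.+2%:R != 0 :> R by rewrite pnatr_eq0.
by field; rewrite f0 !(natr1, nat1r) n1 /=; rewrite -natr1 natr1.
Qed.

(** * Recurrences of the quaternionic Hermite polynomials *)

Lemma quat_conj_comm (R : realType) (q : quat R) : GRing.comm q (quat_conj q).
Proof. by apply: quat_eqP => /=; ring. Qed.

Lemma quat_conjK (R : realType) : involutive (@quat_conj R).
Proof. by case=> a b c d; rewrite /quat_conj /= !opprK. Qed.

(** The binomials vanish above min(m, n), so the range of summation can be made
    the same for neighbouring indices. *)
Lemma hermiteQ_wide (R : realType) m n M (q : quat R) : (minn m n < M)%N ->
  hermiteQ m n q = \sum_(k < M)
    ((-1) ^+ k * (k`! * 'C(m, k) * 'C(n, k))%:R) *:
      (q ^+ (m - k) * quat_conj q ^+ (n - k)).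
Proof.
move=> mnM; rewrite /hermiteQ (big_ord_widen M (fun k => ((-1) ^+ k *
  (k`! * 'C(m, k) * 'C(n, k))%:R) *:
    (q ^+ (m - k) * quat_conj q ^+ (n - k))))//.
rewrite big_mkcond /=; apply: eq_bigr => k _; case: ifPn => //.
rewrite -ltnNge ltnS gtn_min => /orP[] lt_k.
  by rewrite (bin_small lt_k) muln0 mul0n mulr0 scale0r.
by rewrite (bin_small lt_k) muln0 mulr0 scale0r.
Qed.

Lemma hermiteQ_conj (R : realType) m n (q : quat R) :
  hermiteQ m n q = hermiteQ n m (quat_conj q).
Proof.
rewrite /hermiteQ minnC; apply: eq_bigr => k _; rewrite quat_conjK mulnAC.
congr (_ *: _); apply: commrX; apply: commr_sym; apply: commrX.
exact/commr_sym/quat_conj_comm.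
Qed.

Lemma hermiteQ_comm (R : realType) m n (q : quat R) :
  GRing.comm q (hermiteQ m n q).
Proof.
apply: commr_sum => k _; rewrite /GRing.comm -scalerAl -scalerAr.
congr (_ *: _); apply: commrM; apply: commrX => //.
exact: quat_conj_comm.
Qed.

(** Pascal's rule for 'C(m+1, k): the part in 'C(m, k-1) is, after the shift of
    k, the second summand, because (k+1) 'C(n, k+1) = n 'C(n-1, k). *)
Lemma hermiteQSl (R : realType) m n (q : quat R) :
  hermiteQ m.+1 n q = hermiteQ m n q * q - n%:R *: hermiteQ m n.-1 q.
Proof.
rewrite -hermiteQ_comm.
rewrite (@hermiteQ_wide _ m.+1 n m.+2); last by rewrite ltnS geq_minl.
rewrite (@hermiteQ_wide _ m n m.+2); last by rewrite ltnS geq_min leqnSn.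
rewrite (@hermiteQ_wide _ m n.-1 m.+1); last by rewrite ltnS geq_minl.
rewrite [LHS]big_ord_recl [in q * _]big_ord_recl /= mulrDr -[RHS]addrA.
congr (_ + _).
  by rewrite !bin0 !subn0 !mul1r !scale1r exprS mulrA.
rewrite mulr_sumr scaler_sumr -sumrB; apply: eq_bigr => k _.
rewrite /bump /= !add1n subSS -scalerAr mulrA scalerA.
have -> : (n.-1 - k = n - k.+1)%N by rewrite subnS -!subn1 subnAC.
have -> : ((-1) ^+ k.+1 * (k.+1`! * 'C(m, k.+1) * 'C(n, k.+1))%:R) *:
      (q * q ^+ (m - k.+1) * quat_conj q ^+ (n - k.+1)) =
  ((-1) ^+ k.+1 * (k.+1`! * 'C(m, k.+1) * 'C(n, k.+1))%:R) *:
      (q ^+ (m - k) * quat_conj q ^+ (n - k.+1)).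
  (* For k = m the truncated exponent m - k.+1 is wrong, but 'C(m, k.+1) = 0. *)
  have [km|mk] := ltnP k m; first by rewrite -exprS subnSK.
  by rewrite (@bin_small m k.+1)// muln0 mul0n mulr0 !scale0r.
rewrite -scalerBl; congr (_ *: _); rewrite exprS binS factS.
have := congr1 (fun i => i%:R : R) (mul_bin_diag n k).
rewrite !natrM natrD => e.
by transitivity ((-1) ^+ k * k`!%:R *
  (- 'C(m, k.+1)%:R * ('C(n, k.+1)%:R * k.+1%:R)
  - 'C(m, k)%:R * (k.+1%:R * 'C(n, k.+1)%:R)) : R); [|rewrite -e]; ring.
Qed.

Lemma hermiteQSr (R : realType) m n (q : quat R) :
  hermiteQ m n.+1 q = hermiteQ m n q * quat_conj q - m%:R *: hermiteQ m.-1 n q.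
Proof. by rewrite hermiteQ_conj hermiteQSl -!hermiteQ_conj. Qed.

Lemma hermiteQ0 (R : realType) n (q : quat R) :
  hermiteQ 0 n q = quat_conj q ^+ n.
Proof.
by rewrite /hermiteQ min0n big_ord1 /= !bin0 !subn0 mul1r scale1r mul1r.
Qed.

(** * Recurrence of the series *)

Definition hermite_term {R : realType} (x : R) (q : quat R) m n :=
  hermite_coef x n *: hermiteQ m n q.

Lemma hermite_termSSS (R : realType) (x : R) (q : quat R) m n :
  hermite_term x q m.+1 n.+2 =
  hermite_term x q m n.+2 * q - (2 * x) *: hermite_term x q m n.+1 +
  2 *: (hermite_term x q m n * quat_conj q - m%:R *: hermite_term x q m.-1 n).
Proof.
rewrite /hermite_term hermiteQSl /= scalerBr scalerAl -[RHS]addrA.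
congr (_ + _).
rewrite [in LHS]scalerA (mulrC (hermite_coef x n.+2)) hermite_coefSS.
rewrite scalerBl opprB addrC.
rewrite -(scalerA (2 * x) (hermite_coef x n.+1))
  -(scalerA 2 (hermite_coef x n)); congr (_ + _).
rewrite hermiteQSr scalerBr -scalerAl; congr (_ *: (_ - _)).
by rewrite !scalerA mulrC.
Qed.

(** The shifts by 2, 1 and 0 in the partial sums are those of the index n in
    [hermite_termSSS]; the boundary case n = 0 is the sum of two terms. *)
Lemma series_hermite_termS (R : realType) (x : R) (q : quat R) m n :
  series (hermite_term x q m.+1) n.+2 =
  series (hermite_term x q m) n.+2 * q
  - (2 * x) *: series (hermite_term x q m) n.+1 +
  2 *: (series (hermite_term x q m) n * quat_conj q
        - m%:R *: series (hermite_term x q m.-1) n).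
Proof.
elim: n => [|n IH]; last first.
  rewrite [LHS]seriesSr IH hermite_termSSS.
  rewrite addrACA; congr (_ + _).
    rewrite addrACA -opprD -mulrDl -scalerDr.
    by rewrite -(seriesSr _ n.+2) -(seriesSr _ n.+1).
  by rewrite -scalerDr addrACA -opprD -mulrDl -scalerDr -!(seriesSr _ n).
rewrite !seriesSr /series /= !big_geq// !add0r mul0r scaler0 subr0 scaler0 addr0.
rewrite /hermite_term !hermite_coef0 hermite_coef1 !scale1r !hermiteQSl scale0r.
by rewrite subr0 scale1r scalerBr scalerAl addrA -mulrDl.
Qed.

(** * Values of polynomials at a quaternion *)

Lemma quat_normX (R : realType) (p : quat R) n : `|p ^+ n| = `|p| ^+ n.
Proof.
elim: n => [|n IH]; last by rewrite !exprS [LHS]quat_normM -IH.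
by rewrite !expr0 quat_normE /= expr1n !expr0n /= !addr0 sqrtr1.
Qed.

Lemma quat_cvgMl (R : realType) (c l : quat R) (u : nat -> quat R) :
  u @ \oo --> l -> (fun n => u n * c) @ \oo --> l * c.
Proof.
move=> ul; apply/subr_cvg0; apply/norm_cvg0P.
rewrite (_ : (fun n => _) = fun n => `|u n - l| * `|c|); last first.
  by apply/funext => n; rewrite -mulrBl; exact: quat_normM.
rewrite -(mul0r `|c|); apply: cvgM; last exact: cvg_cst.
exact/norm_cvg0P/subr_cvg0.
Qed.

Lemma horner_alg_wide (R : nzRingType) (A : algType R) (a : A) (P : {poly R})
    n :
  (size P <= n)%N -> horner_alg a P = \sum_(i < n) P`_i *: a ^+ i.
Proof.
move=> Pn; rewrite -[in LHS](take_poly_id Pn) /take_poly poly_def linear_sum /=.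
by apply: eq_bigr => i _; rewrite linearZ /= rmorphXn /= horner_algX mulr_algl.
Qed.

Lemma horner_alg_dominated (R : realType) (p : quat R) (P Q : {poly R}) :
  (forall i, `|P`_i| <= Q`_i) -> `|horner_alg p P| <= Q.[`|p|].
Proof.
move=> PQ; rewrite (horner_alg_wide _ _ _ _ _ (leq_maxl (size P) (size Q))).
rewrite (horner_coef_wide _ (leq_maxr (size P) (size Q))).
apply: (le_trans (ler_norm_sum _ _ _)); apply: ler_sum => i _.
by rewrite normrZ quat_normX ler_wpM2r// exprn_ge0.
Qed.

Lemma dominated_exp (R : numDomainType) (P Q : {poly R}) n :
  (forall i, `|P`_i| <= Q`_i) -> forall i, `|(P ^+ n)`_i| <= (Q ^+ n)`_i.
Proof.
move=> PQ; elim: n => [|n IH] i.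
  by rewrite !expr0 coef1 normr_nat.
rewrite !exprS !coefM; apply: (le_trans (ler_norm_sum _ _ _)).
by apply: ler_sum => j _; rewrite normrM ler_pM.
Qed.

(** * Generating function of the Hermite polynomials *)

Section Generating.
Variables (R : realType) (x : R).

Definition gen_exponent : {poly R} := (2 * x) *: 'X - 'X^2.

Definition gen_term j : {poly R} := j`!%:R^-1 *: gen_exponent ^+ j.

(** The formal counterpart of d/dt exp(2xt - t^2) = (2x - 2t) exp(2xt - t^2). *)
Lemma deriv_gen_termS j :
  (gen_term j.+1)^`() = (2 * x) *: gen_term j - 2 *: ('X * gen_term j).
Proof.
have fact_eq : j.+1`!%:R^-1 * j.+1%:R = j`!%:R^-1 :> R.
  by rewrite factS natrM invfM mulrAC mulVf ?pnatr_eq0// mul1r.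
rewrite /gen_term derivZ deriv_exp /= -[_ *+ j.+1]scaler_nat scalerA fact_eq.
rewrite {1}/gen_exponent derivB derivZ derivX derivXn /= expr1.
rewrite -!mul_polyC mulr1 -mulr_natr !rmorphM /= !polyC_natr; ring.
Qed.

Lemma gen_term0_coef j : (gen_term j)`_0 = (j == 0)%:R.
Proof.
rewrite /gen_term coefZ; case: j => [|j]; first by rewrite coef1 invr1 mulr1.
rewrite exprS coefM big_ord1 /gen_exponent coefB coefZ coefX coefXn /=.
by rewrite mulr0 subr0 mul0r mulr0.
Qed.

Lemma gen_termS_coef j n :
  n.+1%:R * (gen_term j.+1)`_n.+1 =
  2 * x * (gen_term j)`_n - 2 * (if n is k.+1 then (gen_term j)`_k else 0).
Proof.
rewrite mulr_natl -coef_deriv deriv_gen_termS coefB !coefZ coefXM.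
by case: n.
Qed.

(** The sums of coefficients obey the recurrence [hermite_coefSS] as a result of
    [gen_termS_coef].  Lowering n lowers M as well, so the bound n < M is
    preserved down to n = 0, where only j = 0 contributes. *)
Lemma sum_gen_term_coef n M : (n < M)%N ->
  \sum_(j < M) (gen_term j)`_n = hermite_coef x n.
Proof.
have sumS k N : k.+1%:R * (\sum_(j < N.+1) (gen_term j)`_k.+1) =
    2 * x * (\sum_(j < N) (gen_term j)`_k) -
    2 * (if k is i.+1 then \sum_(j < N) (gen_term j)`_i else 0).
  rewrite big_ord_recl /= {1}/gen_term expr0 coefZ coef1 mulr0 add0r.
  rewrite mulr_sumr
    (eq_bigr (fun j : 'I_N => _) (fun j _ => gen_termS_coef (val j) k)).
  rewrite sumrB -!mulr_sumr; case: k => //=.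
  by rewrite [X in _ - _ * X]big1.
elim/ltn_ind: n M => -[|[|n]] IH [//|M] nM.
- rewrite big_ord_recl gen_term0_coef big1 ?addr0 ?hermite_coef0// => j _.
  by rewrite gen_term0_coef.
- rewrite -[LHS]mul1r -[1]/(1%:R) sumS IH// hermite_coef0 hermite_coef1.
  by rewrite mulr0 subr0 mulr1.
- apply: (@mulfI _ n.+2%:R); first by rewrite pnatr_eq0.
  by rewrite sumS !IH//; [rewrite hermite_coefSS|exact: ltnW].
Qed.

Lemma size_gen_term j : (size (gen_term j) <= j.*2.+1)%N.
Proof.
apply: (leq_trans (size_scale_leq _ _)).
apply: (leq_trans (size_poly_exp_leq _ _)); rewrite ltnS -mul2n leq_mul2r.
apply/orP; right; rewrite -ltnS.
have : (size gen_exponent <= 3)%N.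
  rewrite (leq_trans (size_polyD _ _))// geq_max size_polyN size_polyXn leqnn.
  by rewrite andbT (leq_trans (size_scale_leq _ _))// size_polyX.
by case: (size _).
Qed.

Lemma gen_term_dominated j i :
  `|(gen_term j)`_i| <= (j`!%:R^-1 *: ((2 * `|x|) *: 'X + 'X^2) ^+ j)`_i.
Proof.
rewrite !coefZ normrM ger0_norm ?invr_ge0 ?ler0n// ler_wpM2l ?invr_ge0 ?ler0n//.
apply: dominated_exp => k; rewrite coefB coefD !coefZ coefX coefXn.
by rewrite (le_trans (ler_normB _ _))// !normrM !normr_nat.
Qed.

Variable p : quat R.

Let r := 2 * `|x| * `|p| + `|p| ^+ 2.

(** P_j has degree at most 2j, so it is its own truncation when j < N/2; when it
    is not, its coefficients are dominated by those of (2|x|X + X^2)^j / j!. *)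
Lemma gen_term_tail j N :
  `|horner_alg p (gen_term j - take_poly N (gen_term j))| <=
  if (j < N./2)%N then 0 else exp_coeff r j.
Proof.
case: ifPn => [jN|_].
  rewrite take_poly_id ?subrr ?rmorph0 ?normr0//.
  rewrite (leq_trans (size_gen_term j))//.
  by rewrite -(odd_double_half N) -leq_double in jN *; lia.
rewrite exp_coeffE /=.
have -> : j`!%:R^-1 * r ^+ j =
    (j`!%:R^-1 *: ((2 * `|x|) *: 'X + 'X^2) ^+ j).[`|p|].
  by rewrite !hornerE.
apply: horner_alg_dominated => i; apply: le_trans (gen_term_dominated j i).
rewrite coefB coef_take_poly; case: ifP => _; last by rewrite subr0.
by rewrite subrr normr0.
Qed.

Lemma series_expq_gen N :
  series (expq_coeff (- p ^+ 2 + (2 * x) *: p)) N =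
  horner_alg p (\sum_(j < N) gen_term j).
Proof.
rewrite /series /= big_mkord linear_sum; apply: eq_bigr => j _.
rewrite /gen_term linearZ /= rmorphXn /= /gen_exponent rmorphB /= linearZ /=.
rewrite rmorphXn /= !horner_algX !mulr_algl.
by rewrite [_ + - _]addrC.
Qed.

Lemma series_hermite_gen N :
  series (fun n => hermite_coef x n *: p ^+ n) N =
  horner_alg p (take_poly N (\sum_(j < N) gen_term j)).
Proof.
rewrite /series /= big_mkord (horner_alg_wide _ _ _ _ _ (size_take_poly _ _)).
apply: eq_bigr => n _; rewrite coef_take_poly ltn_ord coef_sum.
by rewrite sum_gen_term_coef.
Qed.

Lemma series_gen_dist N :
  `|series (expq_coeff (- p ^+ 2 + (2 * x) *: p)) N -
    series (fun n => hermite_coef x n *: p ^+ n) N| <=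
  series (exp_coeff r) N - series (exp_coeff r) N./2.
Proof.
rewrite series_expq_gen series_hermite_gen -rmorphB linear_sum -sumrB.
rewrite rmorph_sum.
apply: (le_trans (ler_norm_sum _ _ _)).
apply: (@le_trans _ _ (\sum_(j < N) if (j < N./2)%N then 0 else exp_coeff r j)).
  by apply: ler_sum => j _; exact: gen_term_tail.
rewrite sub_series_geq; last by rewrite -{2}(odd_double_half N) -addnn; lia.
rewrite -(big_mkord xpredT (fun j => if (j < N./2)%N then 0 else exp_coeff r j)).
rewrite (@big_cat_nat _ _ _ N./2)//=; last first.
  by rewrite -{2}(odd_double_half N) -addnn; lia.
rewrite big_nat big1 ?add0r; last by move=> j /= ->.
rewrite [leLHS]big_nat [leRHS]big_nat le_eqVlt; apply/orP; left; apply/eqP.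
by apply: eq_bigr => j /andP[]; rewrite leqNgt => /negbTE ->.
Qed.

Lemma cvg_half : half @ \oo --> \oo.
Proof.
move=> P [k _ Pk]; exists k.*2 => // n /= kn; apply: Pk => /=.
by rewrite -(doubleK k) half_leq.
Qed.

Lemma hermite_generating :
  series (fun n => hermite_coef x n *: p ^+ n) @ \oo -->
    expq (- p ^+ 2 + (2 * x) *: p).
Proof.
have Ecvg : series (expq_coeff (- p ^+ 2 + (2 * x) *: p)) @ \oo -->
    expq (- p ^+ 2 + (2 * x) *: p) by exact: is_cvg_series_expq.
apply: (cvg_sub0 _ Ecvg); apply/norm_cvg0P.
have ecvg : series (exp_coeff r) @ \oo --> expR r
  by exact: is_cvg_series_exp_coeff.
apply: (@squeeze_cvgr _ _ _ _ (cst 0)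
  (fun N => series (exp_coeff r) N - series (exp_coeff r) N./2)).
- by apply: nearW => N /=; rewrite normr_ge0 distrC series_gen_dist.
- exact: cvg_cst.
- rewrite -(subrr (expR r)); apply: cvgB => //.
  exact: (cvg_comp _ _ cvg_half ecvg).
Qed.

End Generating.

(** * Induction on m *)

(** The three-term recurrence at q' + q/2 - x, where q' is the conjugate of q,
    expanded into the shape of [series_hermite_termS]. *)
Lemma mul_horner_hermiteS (R : realType) (x : R) (q E : quat R) k :
  let h := horner_alg (quat_conj q + 2^-1 *: q - x%:A) in
  E * h (hermite_poly R k.+1) =
  E * h (hermite_poly R k) * q - (2 * x) *: (E * h (hermite_poly R k)) +
  2 *: (E * h (hermite_poly R k) * quat_conj q
        - k%:R *: (E * h (hermite_poly R k.-1))).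
Proof.
move=> h; have hS p : h ('X * p) = h p * h 'X.
  by rewrite mulrC /h rmorphM.
have hZ a p : h (a *: p) = a *: h p by rewrite /h linearZ /= mulr_algl.
have -> : h (hermite_poly R k.+1) =
    h (2 *: ('X * hermite_poly R k)) - h ((2 * k%:R) *: hermite_poly R k.-1).
  by rewrite hermite_polyS /h rmorphB.
rewrite !hZ hS [h 'X]horner_algX mulrBr -!scalerAr mulrA.
move: (E * _) (E * _) => F G.
rewrite mulrBr mulrDr -!scalerAr mulr1 !scalerBr scalerDr !scalerA.
rewrite divff ?pnatr_eq0// scale1r.
by rewrite (addrC _ (G * q)) (addrAC (G * q)) -[LHS]addrA.
Qed.

Lemma cvg_series_hermite_termS (R : realType) (x : R) (q l l' : quat R) k :
  series (hermite_term x q k) @ \oo --> l ->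
  (k%:R *: series (hermite_term x q k.-1) n @[n --> \oo] --> k%:R *: l') ->
  series (hermite_term x q k.+1) @ \oo -->
    l * q - (2 * x) *: l + 2 *: (l * quat_conj q - k%:R *: l').
Proof.
move=> Fk Fk1; rewrite -(cvg_shiftn 2).
have -> : [sequence series (hermite_term x q k.+1) (n + 2)%N]_n =
    (fun n => series (hermite_term x q k) (n + 2)%N * q
     - (2 * x) *: series (hermite_term x q k) (n + 1)%N
     + 2 *: (series (hermite_term x q k) n * quat_conj q
             - k%:R *: series (hermite_term x q k.-1) n)).
  by apply/funext => n; rewrite /= !addn2 addn1 series_hermite_termS.
apply: cvgD; first apply: cvgB.
- by apply: quat_cvgMl; rewrite (cvg_shiftn 2).
- by apply: cvgZr; rewrite (cvg_shiftn 1).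
- by apply: cvgZr; apply: cvgB => //; exact: quat_cvgMl.
Qed.

Theorem theorem5p7 (R : realType) (m : nat) (x : R) (q : quat R) :
  series (fun n => (hermite n x / n`!%:R) *: hermiteQ m n q) @ \oo -->
    expq (- quat_conj q ^+ 2 + (2 * x) *: quat_conj q) *
      horner_alg (quat_conj q + 2^-1 *: q - x%:A) (hermite_poly R m).
Proof.
rewrite -/(hermite_term x q m).
set E := expq _; set h := horner_alg _.
(* The recurrence has order two, so two consecutive indices are carried. *)
suff H k : series (hermite_term x q k) @ \oo --> E * h (hermite_poly R k) /\
    series (hermite_term x q k.+1) @ \oo --> E * h (hermite_poly R k.+1).
  exact: (H m).1.
elim: k => [|k [Fk Fk1]]; last first.
  split=> //; rewrite mul_horner_hermiteS.
  by apply: cvg_series_hermite_termS => //; exact: cvgZr.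
have F0 : series (hermite_term x q 0) @ \oo --> E * h (hermite_poly R 0).
  rewrite hermite_poly0 /h rmorph1 mulr1 /hermite_term.
  under [X in series X]eq_fun do rewrite hermiteQ0.
  exact: hermite_generating.
split=> //; rewrite mul_horner_hermiteS.
apply: cvg_series_hermite_termS => //; rewrite scale0r.
by under eq_fun do rewrite scale0r; exact: cvg_cst.
Qed.
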